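(* Let $n,d,k$ be integers with $1\le d\le \left\lfloor\frac{n-1}{2}\right\rfloor$ and $k\ge 2$. If $G$ is a nonhamiltonian graph on $n$ vertices with minimum degree $\delta(G)\ge d$, then the number $N_k(G)$ of $k$-cliques in $G$ satisfies $$N_k(G)\le \max\left\{h_k(n,d),\ h_k\left(n,\left\lfloor\tfrac{n-1}{2}\right\rfloor\right)\right\}.$$
   Context: All graphs are finite and simple. A graph is nonhamiltonian if it has no hamiltonian cycle (a cycle through all its vertices). $N_k(G)$ denotes the number of unlabeled copies of $K_k$ in $G$ (i.e., the number of $k$-element vertex sets inducing a complete graph). Define $$h_k(n,x):=\binom{n-x}{k}+x\binom{x}{k-1},$$ where for $a\in\mathbb{R}$ and $b\in\mathbb{N}$, $\binom{a}{b}=\frac{1}{b!}a(a-1)\cdots(a-b+1)$ if $a\ge b-1$ and $\binom{a}{b}=0$ otherwise. *)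

(* Defs.v *)
From mathcomp Require Import all_boot all_order all_algebra.

Set Implicit Arguments.
Unset Strict Implicit.
Unset Printing Implicit Defensive.

(* A finite simple graph is a symmetric irreflexive [e : rel T], T : finType. *)

Definition degree (T : finType) (e : rel T) (v : T) : nat := #|[set u | e v u]|.

(* Every degree is < #|T| in a simple graph, so the initial value #|T| does not
   affect the minimum as soon as T is inhabited. *)
Definition min_degree (T : finType) (e : rel T) : nat :=
  \big[minn/#|T|]_(v : T) degree e v.

(* The bound on the size discards the degenerate cyclic sequences of length at
   most 2, for which [ucycleb] can hold although they are not graph cycles. *)
Definition hamiltonian (T : finType) (e : rel T) : Prop :=
  exists s : seq T, [/\ 2 < size s, ucycleb e s & forall x : T, x \in s].

Definition clique (T : finType) (e : rel T) (A : {set T}) : bool :=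
  [forall x in A, forall y in A, (x != y) ==> e x y].

Definition num_cliques (T : finType) (e : rel T) (k : nat) : nat :=
  #|[set A : {set T} | (#|A| == k) && clique e A]|.

(* Only used for x <= n and k >= 2, where the truncated [n - x] and [k.-1] are
   the true differences. *)
Definition h (k n x : nat) : nat := 'C(n - x, k) + x * 'C(x, k.-1).

(* [binomial] on natural arguments is the real binomial coefficient
   a (a - 1) ... (a - b + 1) / b! if a >= b - 1, and 0 otherwise. *)
Lemma bin_convention (R : numFieldType) (a b : nat) :
  ('C(a, b)%:R = if (b%:R - 1 <= a%:R :> R)
                 then b`!%:R^-1 * \prod_(i < b) (a%:R - i%:R)
                 else 0 :> R)%R.
Proof.
have -> : (b%:R - 1 <= a%:R :> R)%R = (b <= a.+1).
  by rewrite Num.Theory.lerBlDr GRing.natr1 Num.Theory.ler_nat.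
case: ifP => [le_b_a1 | /negbT]; last first.
  by rewrite -ltnNge => lt_a1_b; rewrite bin_small // ltnW.
have fb0 : (b`!%:R != 0 :> R)%R by rewrite Num.Theory.pnatr_eq0 -lt0n fact_gt0.
apply: (GRing.mulfI fb0); rewrite GRing.mulVKf //.
rewrite -GRing.natrM mulnC bin_ffact ffact_prod GRing.natr_prod.
apply: eq_bigr => i _; rewrite GRing.natrB //.
by rewrite -ltnS (leq_trans _ le_b_a1).
Qed.

(* Main.v *)
Require Import Defs.
From mathcomp Require Import all_boot.
From mathcomp Require Import zify.

Set Implicit Arguments.
Unset Strict Implicit.
Unset Printing Implicit Defensive.

(** Adding edges keeps the minimum degree at least [d] and does not decrease
    the number of cliques, so [e] may be taken edge-maximal among the
    nonhamiltonian graphs.  Then any two distinct nonadjacent vertices [u] and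
    [v] are the ends of a hamiltonian path, and the predecessors on this path of
    the neighbours of [u] are not adjacent to [v]: otherwise the path could be
    rerouted into a hamiltonian cycle.  This gives Ore's inequality
    deg u + deg v <= n - 1.  When the pair moreover maximises
    deg u + deg v, with deg u <= deg v, each of these predecessors has degree at
    most r = deg u, by comparison of its pair with [v] to the pair of [u] and
    [v].  So there are [r] vertices of degree at most [r], where
    d <= r <= (n - 1) / 2 ([saturated_low_degree]).

    The [k]-cliques that avoid these [r] vertices number at most 'C(n - r, k),
    and each of the [r] vertices lies in at most 'C(r, k - 1) cliques, so there
    are at most [h k n r] of them ([num_cliques_low_degree]).  Finally [h k n]
    is convex in its last argument, so its value at [r] is at most the larger of
    its values at the ends of the interval from [d] to (n - 1) / 2
    ([convex_leq_max]). *)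

(** * Convexity of the bound *)

(** Once a convex sequence has a nonnegative increment, all its later increments
    are nonnegative. *)
Lemma convex_nondecreasing (f : nat -> nat) (a b : nat) :
  (forall x, a <= x -> x.+2 <= b -> 2 * f x.+1 <= f x + f x.+2) ->
  f a <= f a.+1 ->
  forall x, a <= x -> x.+1 <= b -> f x <= f x.+1.
Proof.
move=> fconv fa; elim=> [|x IHx] ax xb; first by have -> : 0 = a by lia.
have [-> //|neq_ax] := eqVneq x.+1 a.
have := IHx ltac:(lia) ltac:(lia).
have := fconv x ltac:(lia) ltac:(lia).
lia.
Qed.

Lemma convex_leq_max (f : nat -> nat) (a b r : nat) :
  (forall x, a <= x -> x.+2 <= b -> 2 * f x.+1 <= f x + f x.+2) ->
  a <= r -> r <= b -> f r <= maxn (f a) (f b).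
Proof.
move: {2}(r - a) (leqnn (r - a)) => m.
elim: m a => [|m IHm] a ra fconv le_ar le_rb.
  have -> : r = a by lia.
  by rewrite leq_maxl.
have [fa|fa] := leqP (f a) (f a.+1).
  have fmono j : r + j <= b -> f r <= f (r + j).
    elim: j => [|j IHj] rjb; first by rewrite addn0.
    have := @convex_nondecreasing f a b fconv fa (r + j) ltac:(lia) ltac:(lia).
    by have := IHj ltac:(lia); rewrite addnS; lia.
  by have := fmono (b - r) ltac:(lia); rewrite subnKC // => frb; lia.
have [->|neq_ra] := eqVneq r a; first by rewrite leq_maxl.
have := IHm a.+1 ltac:(lia) (fun x ax => fconv x (ltnW ax)) ltac:(lia) le_rb.
lia.
Qed.

Lemma bin_convex (a j : nat) : 2 * 'C(a.+1, j) <= 'C(a, j) + 'C(a.+2, j).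
Proof.
case: j => [|j]; first by rewrite !bin0.
rewrite (binS a.+1 j) (binS a j).
have : 'C(a, j) <= 'C(a.+1, j) by apply: leq_bin2l.
lia.
Qed.

Lemma h_convex (k n x : nat) : x.+2 <= n ->
  2 * h k n x.+1 <= h k n x + h k n x.+2.
Proof.
move=> xn; rewrite /h.
have := bin_convex (n - x.+2) k.
have -> : (n - x.+2).+2 = n - x by lia.
have -> : (n - x.+2).+1 = n - x.+1 by lia.
have := bin_convex x k.-1.
have : 'C(x, k.-1) <= 'C(x.+2, k.-1) by apply: leq_bin2l; lia.
move: 'C(x, _) 'C(x.+1, _) 'C(x.+2, _) => c0 c1 c2 c02 cconv.
(* With c0, c1, c2 the three binomials, the second difference of
   x * 'C(x, k - 1) is (x + 1) (c0 + c2 - 2 c1) + (c2 - c0). *)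
have := leq_mul (leqnn x.+1) cconv.
nia.
Qed.

(** * Counting cliques *)

Lemma leq_min_degree (T : finType) (e : rel T) (v : T) :
  min_degree e <= degree e v.
Proof.
rewrite /min_degree; have : v \in index_enum T by rewrite mem_index_enum.
elim: (index_enum T) => // x s IHs; rewrite inE big_cons => /orP[/eqP <-|/IHs].
  exact: geq_minl.
exact: leq_trans (geq_minr _ _).
Qed.

Lemma leq_degree (T : finType) (e e' : rel T) (v : T) :
  subrel e e' -> degree e v <= degree e' v.
Proof.
by move=> ee'; apply/subset_leq_card/subsetP => x; rewrite !inE; apply: ee'.
Qed.

Lemma leq_num_cliques (T : finType) (e e' : rel T) (k : nat) :
  subrel e e' -> num_cliques e k <= num_cliques e' k.
Proof.
move=> ee'; apply/subset_leq_card/subsetP => A; rewrite !inE => /andP[-> /=].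
move=> /forall_inP cA; apply/forall_inP => x xA; apply/forall_inP => y yA.
apply/implyP => xy; apply: ee'.
by have /forall_inP/(_ y yA)/implyP := cA x xA; apply.
Qed.

(** Removing [v] from a clique that contains it leaves a set of neighbours
    of [v], and the clique can be recovered from this set. *)
Lemma num_cliques_at (T : finType) (e : rel T) (k : nat) (v : T) :
  #|[set A : {set T} | [&& #|A| == k, clique e A & v \in A]]|
    <= 'C(degree e v, k.-1).
Proof.
rewrite /degree -cards_draws.
set F := [set A : {set T} | [&& _, _ & _]].
have inj_rem : {in F &, injective (fun A => A :\ v)}.
  move=> A B; rewrite !inE => /and3P[_ _ vA] /and3P[_ _ vB] AB.
  by rewrite -(setD1K vA) AB setD1K.
rewrite -(card_in_imset inj_rem); apply/subset_leq_card/subsetP => B.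
case/imsetP => A; rewrite [A \in F]inE.
case/and3P => /eqP kA /forall_inP cA vA ->.
apply/setIdP; split; last by rewrite -kA (cardsD1 v A) vA.
apply/subsetP => x; rewrite !inE => /andP[xv xA].
have /forall_inP/(_ x xA)/implyP := cA v vA.
by rewrite eq_sym; apply.
Qed.

Lemma num_cliques_low_degree (T : finType) (e : rel T) (k r : nat)
    (S : {set T}) :
  #|S| = r -> (forall x, x \in S -> degree e x <= r) ->
  num_cliques e k <= h k #|T| r.
Proof.
move=> cS lowS; rewrite /num_cliques /h.
pose F v := [set A : {set T} | [&& #|A| == k, clique e A & v \in A]].
pose D := [set A : {set T} | A \subset ~: S & #|A| == k].
have sub : [set A : {set T} | (#|A| == k) && clique e A]
             \subset D :|: \bigcup_(v in S) F v.
  apply/subsetP => A; rewrite !inE => /andP[kA cA]; rewrite kA andbT.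
  have [//|/subsetPn[v vA]] := boolP (A \subset ~: S).
  rewrite inE negbK => vS; apply/bigcupP; exists v => //.
  by rewrite inE kA cA vA.
apply: leq_trans (subset_leq_card sub) _.
apply: leq_trans (leq_card_setU _ _) _; apply: leq_add.
  by rewrite cards_draws cardsCs setCK cS.
have -> : r * 'C(r, k.-1) = \sum_(v in S) 'C(r, k.-1).
  by rewrite sum_nat_const cS.
have : #|\bigcup_(v in S) F v| <= \sum_(v in S) #|F v|.
  elim/big_rec2: _ => [|v m A _ IH]; first by rewrite cards0.
  by apply: leq_trans (leq_card_setU _ _) _; rewrite leq_add2l.
move/leq_trans; apply; apply: leq_sum => v vS.
by apply: leq_trans (num_cliques_at e k v) _; apply: leq_bin2l; apply: lowS.
Qed.

(** * Edge-maximal nonhamiltonian graphs *)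

Definition add_edge (T : finType) (e : rel T) (u v : T) : rel T :=
  [rel x y | [|| e x y, (x == u) && (y == v) | (x == v) && (y == u)]].

Definition saturated (T : finType) (e : rel T) : Prop :=
  forall u v, u != v -> ~~ e u v -> hamiltonian (add_edge e u v).

(** A hamiltonian cycle lists each vertex once, so it is found among the
    finitely many tuples of length [#|T|]. *)
Lemma hamiltonian_dec (T : finType) (e : rel T) : decidable (hamiltonian e).
Proof.
apply: (@decP _ [exists t : #|T|.-tuple T, (2 < size t) && ucycleb e t]).
apply: (iffP existsP) => [[t /andP[t2 ct]]|[s [s2 cs sT]]].
  exists t; split=> // x; have /andP[_ ut] := ct.
  have [||_ ->] := uniq_min_size (s2 := enum T) ut; last by rewrite mem_enum.
    by move=> y _; rewrite mem_enum.
  by rewrite [size t]size_tuple cardE.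
have /andP[_ us] := cs.
have szs : size s == #|T|.
  by rewrite -(card_uniqP us); apply/eqP/eq_card => x; rewrite sT.
by exists (Tuple szs); rewrite s2.
Qed.

Lemma saturation (T : finType) (e : rel T) :
  symmetric e -> irreflexive e -> ~ hamiltonian e ->
  exists e' : rel T, [/\ symmetric e', irreflexive e', subrel e e',
    ~ hamiltonian e' & saturated e'].
Proof.
have [m] := ubnP #|[set p : T * T | ~~ e p.1 p.2]|.
elim: m e => // m IHm e lem esym eirr nh.
pose bad p := [&& p.1 != p.2, ~~ e p.1 p.2
                & ~~ hamiltonian_dec (add_edge e p.1 p.2)].
have [[u v] /and3P[/= uv neuv]|sat] := pickP bad; last first.
  exists e; split=> // u v uv neuv.
  by have := sat (u, v); rewrite /bad /= uv neuv /=; case: hamiltonian_dec.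
case: hamiltonian_dec => // nh' _.
have ee' : subrel e (add_edge e u v) by move=> x y exy; apply/orP; left.
have [||||e' [? ? e'' ? ?]] := IHm (add_edge e u v) => //.
- rewrite -ltnS; apply: leq_trans lem; rewrite ltnS; apply: proper_card.
  apply/properP; split; last first.
    by exists (u, v); rewrite inE //= negbK; apply/or3P/Or32; rewrite !eqxx.
  by apply/subsetP => p; rewrite !inE /= negb_or => /andP[].
- move=> x y; rewrite /add_edge /= esym; congr (_ || _).
  by rewrite orbC ![(y == _) && _]andbC.
- move=> x; rewrite /add_edge /= eirr /=; apply/negbTE; apply: contra uv.
  by case/orP => /andP[/eqP <- /eqP <-].
by exists e'; split=> // x y exy; apply/e''/ee'.
Qed.

Lemma complete_hamiltonian (T : finType) (e : rel T) :
  2 < #|T| -> (forall u v, u != v -> e u v) -> hamiltonian e.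
Proof.
move=> T2 ecomp; exists (enum T); rewrite -cardE; split=> // [|x]; last first.
  by rewrite mem_enum.
move: (enum_uniq T); rewrite cardE in T2; case: (enum T) T2 => // x p p2 up.
rewrite /ucycleb up andbT /= rcons_path.
have /= -> : sorted e (x :: p).
  apply: pairwise_sorted; move: up; rewrite uniq_pairwise.
  by apply: sub_pairwise => y z; apply: ecomp.
case/lastP: p p2 up => // p y _; rewrite last_rcons /= mem_rcons inE.
by case/andP => xyp _; apply: ecomp; apply: contra xyp => /eqP ->; rewrite eqxx.
Qed.

Lemma path_rev (T : eqType) (e : rel T) (x : T) (p : seq T) :
  symmetric e -> path e (last x p) (rev (belast x p)) = path e x p.
Proof. by move=> esym; rewrite rev_path; apply: eq_path => y z; apply: esym. Qed.

(** A hamiltonian cycle of the enlarged graph must use the edge [uv]; deleting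
    that edge leaves the path. *)
Lemma add_edge_hamiltonian_path (T : finType) (e : rel T) (u v : T) :
  symmetric e -> ~ hamiltonian e -> u != v -> hamiltonian (add_edge e u v) ->
  exists p, [/\ path e u p, last u p = v, uniq (u :: p)
              & forall x, x \in u :: p].
Proof.
move=> esym nh uv [s [s2 /andP[cs us] sT]].
have [i p def_p] := rot_to (sT u).
have szp : 1 < size p by rewrite -ltnS (leq_trans s2) // -(size_rot i) def_p.
have up : uniq (u :: p) by rewrite -def_p rot_uniq.
have pT x : x \in u :: p by rewrite -def_p mem_rot.
have cp : cycle (add_edge e u v) (u :: p) by rewrite -def_p rot_cycle.
case: p {def_p} szp up pT cp => // x p szp up pT.
have [uxp /andP[xp _]] := andP up.
rewrite /= rcons_path => /and3P[ux pp pu].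
(* Edges that avoid [u] are already present in [e]. *)
have {}pp : path e x p.
  apply: (sub_in_path (P := predC1 u)) pp => [y z|]; last first.
    by apply/allP => y yp; apply: contra uxp => /eqP <-.
  by rewrite !inE /add_edge /= => /negbTE -> /negbTE ->; rewrite !andbF !orbF.
have xlast : x != last x p.
  case: p szp xp {up pT uxp pp pu} => // y p _ xp.
  by apply: contra xp => /eqP -> /=; rewrite mem_last.
have ne_u y : y \in x :: p -> (y == u) = false.
  by move=> yp; apply/negbTE; apply: contra uxp => /eqP <-.
have xu := ne_u x (mem_head _ _).
have lu := ne_u _ (mem_last x p).
move: ux pu; rewrite /add_edge /= eqxx xu lu (negbTE uv) /= !orbF andbT.
have [eux _|neux /= /eqP xv] := boolP (e u x).
  case/orP => [epu|/eqP lv]; last first.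
    by exists (x :: p); rewrite /= eux.
  case: nh; exists [:: u, x & p]; split=> //.
  by rewrite /ucycleb up /= rcons_path eux pp epu.
rewrite -xv eq_sym (negbTE xlast) orbF => epu.
exists (rev (x :: p)); split.
- by rewrite lastI rev_rcons /= esym epu path_rev.
- by rewrite rev_cons last_rcons.
- by rewrite /= mem_rev rev_uniq.
by move=> y; have := pT y; rewrite !inE mem_rev.
Qed.

(** The cycle runs from [u] along the path up to the predecessor of [y], jumps
    to the far end of the path, and comes back from there to [y]. *)
Lemma crossing_hamiltonian (T : finType) (e : rel T) (u y : T)
    (p1 p2 : seq T) :
  symmetric e -> 2 < #|T| ->
  path e u (p1 ++ y :: p2) -> uniq (u :: p1 ++ y :: p2) ->
  (forall x, x \in u :: p1 ++ y :: p2) ->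
  e u y -> e (last u p1) (last y p2) -> hamiltonian e.
Proof.
move=> esym T2 + up pT euy exv; rewrite cat_path /= => /and3P[pp1 _ pp2].
have perm_c : perm_eq (u :: p1 ++ rev (y :: p2)) (u :: p1 ++ y :: p2).
  by rewrite perm_cons perm_cat2l perm_rev.
exists (u :: p1 ++ rev (y :: p2)); split.
- rewrite (perm_size perm_c) -(card_uniqP up) (leq_trans T2) //.
  by apply/eq_leq/eq_card => x; rewrite pT.
- rewrite /ucycleb (perm_uniq perm_c) up andbT /= rcons_path cat_path pp1 /=.
  rewrite last_cat rev_cons last_rcons esym euy andbT -rev_cons lastI rev_rcons.
  by rewrite /= exv path_rev.
by move=> x; rewrite (perm_mem perm_c) pT.
Qed.

(** The set is made of the predecessors, on the path, of the neighbours of [u].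
    If one of them were adjacent to [v], the two edges would cross and close the
    path into a hamiltonian cycle; and none of them is [v], which comes last. *)
Lemma nonneighbours_of_path_end (T : finType) (e : rel T) (u v : T)
    (p : seq T) :
  symmetric e -> ~ hamiltonian e -> irreflexive e -> 2 < #|T| ->
  path e u p -> last u p = v -> uniq (u :: p) -> (forall x, x \in u :: p) ->
  exists S : {set T}, #|S| = degree e u /\
    (forall x, x \in S -> (x != v) && ~~ e x v).
Proof.
move=> esym nh eirr T2 pp lastp up pT.
pose pred_on y := nth u (u :: p) (index y p).
have nbr_p y : e u y -> y \in p.
  by have := pT y; rewrite inE => /orP[/eqP ->|//]; rewrite eirr.
exists (pred_on @: [set y | e u y]); split.
  apply: card_in_imset => y z; rewrite !inE => /nbr_p yp /nbr_p zp.
  move/eqP; rewrite nth_uniq //= ?ltnS ?index_size // => /eqP yz.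
  by rewrite -(nth_index u yp) yz nth_index.
move=> x /imsetP[y]; rewrite inE => euy ->.
have yp := nbr_p y euy; clear nbr_p.
case/splitPr: yp pp lastp up pT @pred_on.
move=> p1 p2 pp lastp up pT pred_on.
have yp1 : y \notin p1.
  by move: up; rewrite /= cat_uniq /= => /and4P[_ _ /norP[]].
have -> : pred_on y = last u p1.
  rewrite /pred_on index_cat (negbTE yp1) /= eqxx addn0 -cat_cons nth_cat /=.
  by rewrite leqnn nth_last.
move: lastp; rewrite last_cat /= => lastp.
apply/andP; split; last first.
  apply/negP; rewrite -lastp => exv.
  by case: nh; apply: crossing_hamiltonian exv.
apply/eqP => eqv; move: up; rewrite -cat_cons cat_uniq => /and3P[_ /negP[]].
by apply/hasP; exists v; rewrite /= -?lastp ?mem_last // lastp -eqv mem_last.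
Qed.

(** For a nonadjacent pair [u], [v] of largest degree sum with
    deg u <= deg v, the set of the previous lemma consists of vertices
    of degree at most deg u, and it is disjoint from [v] and its neighbours,
    whence deg u + deg v <= n - 1. *)
Lemma saturated_low_degree (T : finType) (e : rel T) :
  symmetric e -> irreflexive e -> ~ hamiltonian e -> saturated e ->
  2 < #|T| ->
  exists (u : T) (S : {set T}),
    [/\ degree e u <= #|T|.-1./2, #|S| = degree e u
      & forall x, x \in S -> degree e x <= degree e u].
Proof.
move=> esym eirr nh sat T2.
pose nonadj (q : T * T) := (q.1 != q.2) && ~~ e q.1 q.2.
have [q0 nq0|full] := pickP nonadj; last first.
  case: nh; apply: complete_hamiltonian => // u v uv.
  by have := full (u, v); rewrite /nonadj /= uv => /negbFE.
case: (@arg_maxnP _ q0 nonadj (fun q => degree e q.1 + degree e q.2) nq0).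
move=> [u v] /andP[/= uv neuv] umax.
wlog le_uv : u v uv neuv umax / degree e u <= degree e v.
  move=> wl; have [|/ltnW vu] := leqP (degree e u) (degree e v); first exact: wl.
  apply: (wl v u) vu; rewrite 1?eq_sym 1?esym // => q /umax.
  by rewrite (addnC (degree e v)).
have [p [pp lastp up pT]] :=
  add_edge_hamiltonian_path esym nh uv (sat _ _ uv neuv).
have [S [cS nS]] := nonneighbours_of_path_end esym nh eirr T2 pp lastp up pT.
exists u, S; split=> // [|x /nS xv]; last first.
  by have := umax (x, v) xv; rewrite /= leq_add2r.
have : #|S :|: [set y | e v y]| <= #|~: [set v]|.
  apply/subset_leq_card/subsetP => x; rewrite !inE => /orP[/nS/andP[] //|].
  by apply: contraTneq => ->; rewrite eirr.
rewrite cardsC1 cardsU (_ : S :&: _ = set0) ?cards0 ?subn0 ?cS; last first.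
  apply/setP => x; rewrite !inE; apply/negbTE/negP => /andP[/nS/andP[_ /negP]].
  by rewrite esym.
rewrite -/(degree e v) => ore.
by rewrite geq_half_double -addnn (leq_trans _ ore) // leq_add2l.
Qed.

Theorem theorem6 (n d k : nat) (T : finType) (e : rel T)
  (d_ge1 : 1 <= d) (d_le : d <= n.-1./2) (k_ge2 : 2 <= k)
  (e_sym : symmetric e) (e_irr : irreflexive e)
  (card_T : #|T| = n)
  (e_nonham : ~ hamiltonian e)
  (e_mindeg : d <= min_degree e) :
  num_cliques e k <= maxn (h k n d) (h k n n.-1./2).
Proof.
have T2 : 2 < #|T| by lia.
have [e' [esym' eirr' ee' nh' sat]] := saturation e_sym e_irr e_nonham.
have [u [S [ru cS lowS]]] := saturated_low_degree esym' eirr' nh' sat T2.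
apply: leq_trans (leq_num_cliques k ee') _.
apply: leq_trans (num_cliques_low_degree k cS lowS) _.
rewrite card_T in ru *.
apply: convex_leq_max => // [x _ xn|]; first by apply: h_convex; lia.
exact: leq_trans e_mindeg (leq_trans (leq_min_degree e u) (leq_degree u ee')).
Qed.
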